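(* Let $m\geq 2$ be an integer, and let $S=\{a_1^m,\ldots,a_k^m\}$ be a set of $k$ distinct $m$th powers of integers $a_1,\ldots,a_k$. Define polynomials in $\mathbb{Z}[x]$ by \[ g(x)=(x-a_1)\cdots(x-a_k),\qquad f_S(x)=\bigl(x(x^2+1)g(x)\bigr)^{4m}+(x^{2m}-x^2+2)\,g(x)^{2m}+x^m . \] Then: (i) $S\subseteq f_S(\mathbb{Z})\cap \mathcal{P}_m$; (ii) $f_S(x)\notin \mathcal{P}_m$ for every $x\in \mathbb{Z}\setminus\{0,a_1,\ldots,a_k\}$; (iii) $f_S(\mathbb{Z})\cap \mathcal{P}_m=S$.
   Context: For an integer $m\geq 2$, $\mathcal{P}_m=\{a^m : a\in\mathbb{Z}\}$ denotes the set of all perfect $m$th powers of integers. For a polynomial $f\in\mathbb{Z}[x]$, $f(\mathbb{Z})=\{f(n): n\in\mathbb{Z}\}$. An empty product equals $1$. *)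

(* Defs.v *)
From mathcomp Require Import all_boot all_order all_algebra.
From mathcomp Require Import mathcomp_extra boolp classical_sets.
Set Implicit Arguments.
Unset Strict Implicit.
Unset Printing Implicit Defensive.
Import Order.TTheory GRing.Theory Num.Theory.
Local Open Scope ring_scope.
Local Open Scope classical_set_scope.

Definition perfect_powers (m : nat) : set int := range (fun a : int => a ^+ m).

Definition poly_values (f : {poly int}) : set int := range (fun n : int => f.[n]).

Definition g_poly (k : nat) (a : 'I_k -> int) : {poly int} :=
  \prod_(i < k) ('X - (a i)%:P).

(* The polynomial f_S depends on the chosen roots a_i, not only on the set S
   of their m-th powers: for even m a root may be replaced by its opposite. *)
Definition f_poly (m k : nat) (a : 'I_k -> int) : {poly int} :=
  ('X * ('X^2 + 1) * g_poly a) ^+ (4 * m)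
  + ('X^(2 * m) - 'X^2 + 2%:P) * g_poly a ^+ (2 * m) + 'X^m.

(* Main.v *)
Require Import Defs.
From mathcomp Require Import all_boot all_order all_algebra.
From mathcomp Require Import mathcomp_extra boolp classical_sets.
From mathcomp Require Import zify ring lra.
Import Order.TTheory GRing.Theory Num.Theory.
Local Open Scope ring_scope.
Local Open Scope classical_set_scope.

(** For [x] outside [{0, a_1, ..., a_k}] put [A = x (x^2 + 1) g(x)], a nonzero
    integer. The last two terms of [f_S(x)] are together positive but smaller
    than [(A^4)^(m-1)], so [f_S(x)] lies strictly between the consecutive
    [m]th powers [(A^4)^m] and [(A^4 + 1)^m]. At a root of [g] the value is
    [a_i^m], and at [0], if [g(0) <> 0], it is [2 (g(0)^2)^m], which the 2-adic
    valuation shows not to be an [m]th power. *)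

(** The exponents [4 * m] and [2 * m] are split so that the leading term is visibly an [m]th
    power. *)
Lemma horner_f_poly (m k : nat) (a : 'I_k -> int) (x : int) :
  (f_poly m a).[x] =
    ((x * (x ^+ 2 + 1) * (g_poly a).[x]) ^+ 4) ^+ m
    + ((x ^+ m) ^+ 2 - x ^+ 2 + 2) * (((g_poly a).[x]) ^+ m) ^+ 2 + x ^+ m.
Proof.
rewrite /f_poly 2!hornerD hornerM hornerD hornerD hornerN !horner_exp.
rewrite 2!hornerM hornerD !hornerXn hornerX !hornerC.
by rewrite [X in X + x ^+ m]/= !exprM ![_ ^+ m ^+ 2]exprAC.
Qed.

Lemma root_g_poly (k : nat) (a : 'I_k -> int) (x : int) :
  ((g_poly a).[x] == 0) = [exists i, x == a i].
Proof.
rewrite /g_poly horner_prod; apply/prodf_eq0/existsP => -[i].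
  by move=> _; rewrite hornerXsubC subr_eq0; exists i.
by move=> /eqP ->; exists i; rewrite ?hornerXsubC ?subrr.
Qed.

(** Since [y] is positive, a root [b] can be replaced by [|b|]; monotonicity of the power then gives
    [B < |b| < B + 1]. *)
Lemma not_perfect_power_between (m : nat) (B y : int) :
  0 <= B -> B ^+ m < y < (B + 1) ^+ m -> ~ perfect_powers m y.
Proof.
move=> B0 /andP[lo hi] [b _ by_].
have y0 : 0 < y by apply: le_lt_trans lo; apply: exprn_ge0.
have bE : `|b| ^+ m = y by rewrite -normrX by_ gtr0_norm.
have m0 : m != 0%N by apply/eqP => m0; move: lo hi; rewrite m0 !expr0; lia.
by move: lo hi; rewrite -bE !ltr_pXn2r ?lt0n ?nnegrE ?addr_ge0 //; lia.
Qed.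

(** Modulo [m], the 2-adic valuation of [2 * c ^+ m] is 1, whereas that of an [m]th power is 0. *)
Lemma not_perfect_power_double (m : nat) (c : int) :
  (1 < m)%N -> c != 0 -> ~ perfect_powers m (2 * c ^+ m).
Proof.
move=> m1 c0 [b _ /(congr1 absz)]; rewrite abszM !abszX => bc.
have c0' : (0 < `|c| ^ m)%N by rewrite expn_gt0 absz_gt0 c0.
have := congr1 (logn 2) bc.
rewrite lognM // !lognX ![(m * _)%N]mulnC (_ : logn 2 `|2%R : int| = 1%N) //.
move=> /(congr1 (modn^~ m)).
by rewrite modnMl addnC modnMDl modn_small.
Qed.

Lemma f_poly_bounds (m : nat) (x G : int) :
  (2 <= m)%N -> x != 0 -> G != 0 ->
  let B := (x * (x ^+ 2 + 1) * G) ^+ 4 in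
  let y := B ^+ m + ((x ^+ m) ^+ 2 - x ^+ 2 + 2) * (G ^+ m) ^+ 2 + x ^+ m in
  B ^+ m < y < (B + 1) ^+ m.
Proof.
move=> hm x0 G0 /=; set B := _ ^+ 4; set y := _ + x ^+ m.
(* The last inequality, equivalent to [2 <= m], lets the exponent 4 in [B] absorb the [2m]th powers
   of the tail. *)
have [m0 m1 m24] : [/\ 0 < m, 0 < m.-1 & m * 2 <= 4 * m.-1]%N.
  by clear -hm; split; lia.
have x1 : 1 <= `|x| by rewrite -gtz0_ge1 normr_gt0.
have G1 : 1 <= `|G| by rewrite -gtz0_ge1 normr_gt0.
have B0 : 0 <= B by rewrite /B (exprM _ 2 2) sqr_ge0.
have xt : x ^+ 2 <= `|x| ^+ m by rewrite -real_normK ?num_real // ler_weXn2l.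
have x2 : 1 <= x ^+ 2 by rewrite -real_normK ?num_real // exprn_ege1.
have xm2 : (x ^+ m) ^+ 2 = (`|x| ^+ m) ^+ 2.
  by rewrite -normrX real_normK ?num_real.
have Gm2 : (G ^+ m) ^+ 2 = (`|G| ^+ m) ^+ 2.
  by rewrite -normrX real_normK ?num_real.
have w1 : 1 <= (`|G| ^+ m) ^+ 2 by rewrite !exprn_ege1.
have xmP : - `|x| ^+ m <= x ^+ m <= `|x| ^+ m by rewrite -ler_norml normrX.
(* The constant is [2 ^+ 4], from [x ^+ 2 + 1 >= 2]. *)
have zB : 16 * (`|x| * `|G|) ^+ 4 <= B.
  have -> : B = (x ^+ 2 + 1) ^+ 4 * (`|x| * `|G|) ^+ 4.
    have norm4 z : `|z : int| ^+ 4 = z ^+ 4.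
      by rewrite !(exprM _ 2 2) real_normK ?num_real.
    by rewrite exprMn !norm4 /B; ring.
  rewrite ler_wpM2r ?exprn_ge0 ?mulr_ge0 //.
  have -> : (16 : int) = 2 ^+ 4 by [].
  by rewrite ler_pXn2r ?nnegrE //; lia.
have z1 : 1 <= `|x| * `|G| by rewrite mulr_ege1.
have Blarge : 16 * ((`|x| ^+ m) ^+ 2 * (`|G| ^+ m) ^+ 2) <= B ^+ m.-1.
  apply: (@le_trans _ _ ((16 * (`|x| * `|G|) ^+ 4) ^+ m.-1)); last first.
    by rewrite ler_pXn2r ?nnegrE // mulr_ge0 // exprn_ge0 ?mulr_ge0.
  rewrite [leRHS]exprMn -!exprM -exprMn ler_pM ?exprn_ge0 ?mulr_ge0 //.
    by rewrite -[leLHS]expr1 ler_weXn2l.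
  by rewrite ler_weXn2l.
(* One factor [B + 1] is kept and the others are lowered to [B]. *)
have BS : B ^+ m + B ^+ m.-1 <= (B + 1) ^+ m.
  rewrite -{1 3}(prednK m0) !exprS -{2}[B ^+ _]mul1r -mulrDl ler_wpM2l ?addr_ge0 //.
  by rewrite lerXn2r ?nnegrE ?addr_ge0 // lerDl.
rewrite /y xm2 Gm2; move: Blarge BS xmP w1 xt x2.
set t := `|x| ^+ m; set w := (_ ^+ m) ^+ 2.
(* What remains is arithmetic in [t] and [w]: the tail is at least [(t - 1)^2 + 1 > 0], and at most
   [3 * t^2 * w], below [16 * t^2 * w <= B ^+ m.-1]. *)
move: (B ^+ m) (B ^+ m.-1) ((B + 1) ^+ m) (x ^+ 2) (x ^+ m) t w.
move=> b c d q s t w cL dL /andP[sL sU] w1 qt q1.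
have t1 : 1 <= t by apply: le_trans qt.
have tt : t <= t ^+ 2 by rewrite expr2 ler_peMl // (le_trans _ t1).
have tail0 : 0 <= t ^+ 2 - q + 2 by lra.
have tailL : t ^+ 2 - q + 2 <= (t ^+ 2 - q + 2) * w by rewrite ler_peMr.
have tailU : (t ^+ 2 - q + 2) * w <= (t ^+ 2 + 1) * w.
  by rewrite ler_wpM2r ?(le_trans _ w1) //; lra.
have t2 : 2 * t <= t ^+ 2 + 1 by have := sqr_ge0 (t - 1); rewrite sqrrB1; lra.
have tw : t ^+ 2 <= t ^+ 2 * w by rewrite ler_peMr // sqr_ge0.
have ww : w <= t ^+ 2 * w by rewrite ler_peMl ?(le_trans _ w1) // (le_trans t1).
by apply/andP; split; rewrite ?mulrDl ?mul1r in tailU *; lra.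
Qed.

Theorem theorem3p1 (m : nat) (hm : (2 <= m)%N) (k : nat) (a : 'I_k -> int)
    (ha : injective (fun i : 'I_k => a i ^+ m))
    (S : set int) (hS : S = range (fun i : 'I_k => a i ^+ m)) :
  [/\ S `<=` poly_values (f_poly m a) `&` perfect_powers m,
      forall x : int, ~ ([set 0] `|` range a) x ->
        ~ perfect_powers m (f_poly m a).[x]
    & poly_values (f_poly m a) `&` perfect_powers m = S].
Proof.
have m0 : (0 < m)%N by apply: ltnW.
have f_root i : (f_poly m a).[a i] = a i ^+ m.
  have /eqP g0 : (g_poly a).[a i] == 0.
    by rewrite root_g_poly; apply/existsP; exists i.
  by rewrite horner_f_poly g0 mulr0 !expr0n !eqn0Ngt m0 /= expr0n mulr0 add0r ?add0r.
have incl : S `<=` poly_values (f_poly m a) `&` perfect_powers m.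
  by rewrite hS => _ [i _ <-]; split; [exists (a i) | exists (a i)].
have avoid x : ~ ([set 0] `|` range a) x -> ~ perfect_powers m (f_poly m a).[x].
  move=> nx; rewrite horner_f_poly.
  have x0 : x != 0 by apply/eqP => x0; apply: nx; left.
  have g0 : (g_poly a).[x] != 0.
    by rewrite root_g_poly; apply/existsP => -[i /eqP xi]; apply: nx; right; exists i.
  apply: not_perfect_power_between (f_poly_bounds _ _ _ hm x0 g0).
  by rewrite (exprM _ 2 2) sqr_ge0.
split=> //; apply/seteqP; split=> // _ [[x _ <-] fP].
(* Roots of [g] come first, so the case [x = 0] is met only when [g(0)] is nonzero. *)
have [[i _ xi]|nx] := pselect (range a x).
  by rewrite hS -xi f_root; exists i.
have [x0|x0] := eqVneq x 0; last first.
  by case: (avoid x) => // -[/eqP|//]; rewrite (negbTE x0).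
have g0 : (g_poly a).[x] != 0.
  by rewrite root_g_poly; apply/existsP => -[i /eqP xi]; apply: nx; exists i.
(* At 0 only the constant 2 of the middle factor survives, leaving [2 * g(0)^(2m)]. *)
exfalso; apply: (@not_perfect_power_double m ((g_poly a).[x] ^+ 2)) => //.
  by rewrite expf_neq0.
move: fP; rewrite horner_f_poly {1 3 4 5}x0 !mul0r !expr0n !eqn0Ngt m0 /=.
by rewrite !expr0n subr0 !add0r x0 expr0n eqn0Ngt m0 addr0 exprAC.
Qed.
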